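(* Let $k \geq 2$ be an integer, let $R_1, \ldots, R_k$ be finite commutative rings with identity, and let $R$ be the direct product $R_1 \times \cdots \times R_k$. Let $I$ be the ideal of vanishing polynomials in $R[x]$, and for each $1 \leq i \leq k$ let $I_i$ be the ideal of vanishing polynomials in $R_i[x]$. Then the ring of polynomial functions on $R$ is isomorphic to the direct product of the rings of polynomial functions on $R_1, \ldots, R_k$; in other words, there is a ring isomorphism $$R[x]/I \cong R_1[x]/I_1 \times \cdots \times R_k[x]/I_k.$$
   Context: Rings are commutative with identity. For a ring $S$, a polynomial $F(x) \in S[x]$ (a formal polynomial) is called a vanishing polynomial if $F(a) = 0$ for all $a \in S$; the zero polynomial is a vanishing polynomial. The vanishing polynomials form an ideal $J$ of $S[x]$. A polynomial function on $S$ is a function $f : S \to S$ for which there is a polynomial $F(x) \in S[x]$ with $f(r) = F(r)$ for all $r \in S$. Polynomial functions on $S$ form a ring under pointwise addition and multiplication, and this ring is identified with the quotient $S[x]/J$. *)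

(* Defs.v *)
From HB Require Import structures.
From mathcomp Require Import all_boot all_order all_algebra.
From mathcomp Require Import boolp.

Set Implicit Arguments.
Unset Strict Implicit.
Unset Printing Implicit Defensive.

Import GRing.Theory.
Local Open Scope ring_scope.

(* Commutative rings are [comPzRingType]s and may therefore be trivial. *)

Definition ring_isomorphic (A B : pzRingType) : Prop :=
  exists phi : {rmorphism A -> B}, bijective phi.

Section DirectProduct.
Variables (I : finType) (T : I -> comPzRingType).
Implicit Types f g h : {dffun forall i, T i}.

Definition dffun_zero : {dffun forall i, T i} := [ffun i => (0 : T i)].
Definition dffun_one : {dffun forall i, T i} := [ffun i => (1 : T i)].
Definition dffun_opp f : {dffun forall i, T i} := [ffun i => - (f i : T i)].
Definition dffun_add f g : {dffun forall i, T i} :=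
  [ffun i => (f i : T i) + g i].
Definition dffun_mul f g : {dffun forall i, T i} :=
  [ffun i => (f i : T i) * g i].

Fact dffun_addA : associative dffun_add.
Proof. by move=> f g h; apply/ffunP => i; rewrite !ffunE addrA. Qed.
Fact dffun_addC : commutative dffun_add.
Proof. by move=> f g; apply/ffunP => i; rewrite !ffunE addrC. Qed.
Fact dffun_add0 : left_id dffun_zero dffun_add.
Proof. by move=> f; apply/ffunP => i; rewrite !ffunE add0r. Qed.
Fact dffun_addN : left_inverse dffun_zero dffun_opp dffun_add.
Proof. by move=> f; apply/ffunP => i; rewrite !ffunE addNr. Qed.
HB.instance Definition _ := GRing.isZmodule.Build {dffun forall i, T i}
  dffun_addA dffun_addC dffun_add0 dffun_addN.

Fact dffun_mulA : associative dffun_mul.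
Proof. by move=> f g h; apply/ffunP => i; rewrite !ffunE mulrA. Qed.
Fact dffun_mulC : commutative dffun_mul.
Proof. by move=> f g; apply/ffunP => i; rewrite !ffunE mulrC. Qed.
Fact dffun_mul1 : left_id dffun_one dffun_mul.
Proof. by move=> f; apply/ffunP => i; rewrite !ffunE mul1r. Qed.
Fact dffun_mulDl : left_distributive dffun_mul dffun_add.
Proof. by move=> f g h; apply/ffunP => i; rewrite !ffunE mulrDl. Qed.
HB.instance Definition _ := GRing.Zmodule_isComPzRing.Build
  {dffun forall i, T i} dffun_mulA dffun_mulC dffun_mul1 dffun_mulDl.
End DirectProduct.

Definition prod_ring (I : finType) (T : I -> comPzRingType) : comPzRingType :=
  {dffun forall i, T i}.

Definition fin_prod_ring (I : finType) (T : I -> finComPzRingType) :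
    finComPzRingType :=
  HB.pack {dffun forall i, T i} (GRing.ComPzRing.on (prod_ring T))
    (Finite.on {dffun forall i, T i}).

Section Polynomials.
Variable S : comPzRingType.

Definition nz_ring (nz : 1 != 0 :> S) : comNzRingType :=
  HB.pack (GRing.ComPzRing.sort S) (GRing.PzSemiRing_isNonZero.Build S nz).

Definition nontrivial_dec : decidable (1 != 0 :> S) := decP idP.

(* The type [{poly _}] only exists over nontrivial rings.  If 1 = 0 in S, then
   S[x] is the trivial ring, that is S itself: every polynomial is constant. *)
Definition poly_ring : comPzRingType :=
  match nontrivial_dec with
  | left nz => {poly nz_ring nz}
  | right _ => S
  end.

Definition poly_eval : poly_ring -> S -> S :=
  match nontrivial_dec as d return
    (match d with
     | left nz => {poly nz_ring nz} : comPzRingType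
     | right _ => S
     end -> S -> S) with
  | left nz => fun F a => F.[a]
  | right _ => fun F _ => F
  end.

End Polynomials.

Section PolyEval.
Variable S : comPzRingType.
Implicit Types (F G : poly_ring S) (a : S).

Fact poly_eval_zmod a : zmod_morphism (fun F => poly_eval F a).
Proof.
rewrite /poly_eval /poly_ring; case: nontrivial_dec => nz F G //.
by rewrite -[LHS]/((F - G : {poly nz_ring nz}).[a]) hornerD hornerN.
Qed.

Fact poly_eval_monoid a : monoid_morphism (fun F => poly_eval F a).
Proof.
rewrite /poly_eval /poly_ring; case: nontrivial_dec => nz; split=> // [|F G].
  exact: (@hornerC (nz_ring nz)).
exact: (@hornerM (nz_ring nz)).
Qed.

Lemma poly_evalB F G a : poly_eval (F - G) a = poly_eval F a - poly_eval G a.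
Proof. exact: poly_eval_zmod. Qed.
Lemma poly_evalM F G a : poly_eval (F * G) a = poly_eval F a * poly_eval G a.
Proof. exact: (poly_eval_monoid a).2. Qed.
Lemma poly_eval0 a : poly_eval 0 a = 0 :> S.
Proof. by rewrite -[0](subrr 0) poly_evalB subrr. Qed.
Lemma poly_eval1 a : poly_eval 1 a = 1 :> S.
Proof. exact: (poly_eval_monoid a).1. Qed.
End PolyEval.

Section VanishingIdeal.
Variable S : finComPzRingType.

Definition vanishing : {pred poly_ring S} :=
  fun F => [forall a, poly_eval F a == 0].

Lemma vanishingP (F : poly_ring S) :
  reflect (forall a, poly_eval F a = 0) (F \in vanishing).
Proof. exact: 'forall_eqP. Qed.

Fact vanishing_zmod_closed : zmod_closed vanishing.
Proof.
split=> [|F G /vanishingP F0 /vanishingP G0]; apply/vanishingP => a.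
  exact: poly_eval0.
by rewrite poly_evalB F0 G0 subrr.
Qed.
HB.instance Definition _ :=
  GRing.isZmodClosed.Build _ vanishing vanishing_zmod_closed.

Lemma vanishingMl (G F : poly_ring S) :
  F \in vanishing -> G * F \in vanishing.
Proof.
by move=> /vanishingP F0; apply/vanishingP => a; rewrite poly_evalM F0 mulr0.
Qed.

(* S[x]/J as an additive group; the multiplication is added below because
   the ring structure of [{ideal_quot _}] assumes that S[x] is nontrivial. *)
Definition poly_quot := {ideal_quot vanishing}.
HB.instance Definition _ := GRing.Zmodule.on poly_quot.
HB.instance Definition _ := EqQuotient.on poly_quot.

Definition poly_quot_one : poly_quot := \pi_poly_quot%qT 1.
Definition poly_quot_mul := lift_op2 poly_quot *%R.

Lemma pi_poly_quotP (F G : poly_ring S) :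
  \pi_poly_quot%qT F = \pi_poly_quot%qT G <-> F - G \in vanishing.
Proof. by rewrite Quotient.idealrBE; split=> /eqP. Qed.

Lemma pi_poly_quotM (F G : poly_ring S) :
  \pi_poly_quot%qT (F * G)
  = poly_quot_mul (\pi_poly_quot%qT F) (\pi_poly_quot%qT G).
Proof.
unlock poly_quot_mul; apply/pi_poly_quotP; set F' := repr _; set G' := repr _.
have F'F : F - F' \in vanishing by apply/pi_poly_quotP; rewrite reprK.
have G'G : G - G' \in vanishing by apply/pi_poly_quotP; rewrite reprK.
have -> : F * G - F' * G' = G * (F - F') + F' * (G - G').
  by rewrite !mulrBr addrA [G * F]mulrC [G * F']mulrC subrK.
by rewrite rpredD ?vanishingMl.
Qed.

Fact poly_quot_mulA : associative poly_quot_mul.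
Proof.
move=> x y z; rewrite -[x]reprK -[y]reprK -[z]reprK.
by rewrite -!pi_poly_quotM mulrA.
Qed.
Fact poly_quot_mulC : commutative poly_quot_mul.
Proof.
by move=> x y; rewrite -[x]reprK -[y]reprK -!pi_poly_quotM mulrC.
Qed.
Fact poly_quot_mul1 : left_id poly_quot_one poly_quot_mul.
Proof. by move=> x; rewrite -[x]reprK -pi_poly_quotM mul1r. Qed.
Fact poly_quot_mulDl : left_distributive poly_quot_mul +%R.
Proof.
move=> x y z; rewrite -[x]reprK -[y]reprK -[z]reprK.
have piD F G : \pi_poly_quot%qT (F + G)
    = (\pi_poly_quot%qT F : poly_quot) + \pi_poly_quot%qT G.
  exact: Quotient.pi_add.
by rewrite -piD -!pi_poly_quotM -piD mulrDl.
Qed.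
HB.instance Definition _ := GRing.Zmodule_isComPzRing.Build poly_quot
  poly_quot_mulA poly_quot_mulC poly_quot_mul1 poly_quot_mulDl.
End VanishingIdeal.

Section PolynomialFunctions.
Variable S : finComPzRingType.

Definition poly_function : {pred {ffun S -> S}} :=
  fun f => `[< exists F : poly_ring S, forall r, f r = poly_eval F r >].

Lemma poly_functionP (f : {ffun S -> S}) :
  reflect (exists F : poly_ring S, forall r, f r = poly_eval F r)
          (f \in poly_function).
Proof. exact: asboolP. Qed.

Fact poly_function_subring_closed : subring_closed poly_function.
Proof.
split=> [|f g /poly_functionP[F Ff] /poly_functionP[G Gg]
         |f g /poly_functionP[F Ff] /poly_functionP[G Gg]];
  apply/poly_functionP.
- by exists 1 => r; rewrite ffunE poly_eval1.
- by exists (F - G) => r; rewrite !ffunE poly_evalB Ff Gg.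
- by exists (F * G) => r; rewrite !ffunE poly_evalM Ff Gg.
Qed.
HB.instance Definition _ :=
  GRing.isSubringClosed.Build _ poly_function poly_function_subring_closed.

Record polyfun := Polyfun {
  polyfun_val :> {ffun S -> S};
  polyfun_valP : polyfun_val \in poly_function }.

HB.instance Definition _ := [isSub for polyfun_val].
HB.instance Definition _ := [Choice of polyfun by <:].
HB.instance Definition _ :=
  GRing.SubChoice_isSubPzRing.Build _ _ polyfun (subringClosedP _).

Fact polyfun_mulC : commutative (@GRing.mul polyfun).
Proof.
by move=> f g; apply/val_inj/ffunP => r; rewrite !rmorphM !ffunE mulrC.
Qed.
HB.instance Definition _ :=
  GRing.PzRing_hasCommutativeMul.Build polyfun polyfun_mulC.
End PolynomialFunctions.

(* Main.v *)
From HB Require Import structures.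
Require Import Defs.
From mathcomp Require Import all_boot all_algebra.
From mathcomp Require Import boolp.

(** The polynomial functions on a ring S are the functions
    a |-> c_0 + c_1 a + ... + c_(n-1) a^(n-1), and on a direct product such an
    expression is computed coordinatewise.  Hence the functions on the product
    that are given by a polynomial are exactly those that act on the i-th
    coordinate by a polynomial over R_i; padding with zero coefficients brings
    these polynomials to a common length.  The ring of polynomial functions and
    the quotient S[x]/J both embed in the ring of all functions S -> S with
    image the polynomial functions, so both isomorphisms come from comparing two
    subrings of the ring of functions on the product. *)

Set Implicit Arguments.
Unset Strict Implicit.
Unset Printing Implicit Defensive.

Import GRing.Theory.
Local Open Scope ring_scope.

(** Send [x] to the [y] with [g y = f x]. Since [g] is injective, the ring identities for this
    choice can be checked in [C], where they hold because [f] and [g] are morphisms; the inverse is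
    chosen in the same way from the reverse inclusion of images. *)
Lemma ring_isomorphic_same_image (A B C : pzRingType)
    (f : {rmorphism A -> C}) (g : {rmorphism B -> C}) :
  injective f -> injective g ->
  (forall x, exists y, g y = f x) -> (forall y, exists x, f x = g y) ->
  ring_isomorphic A B.
Proof.
move=> finj ginj fg gf.
pose phi x : B := projT1 (cid (fg x)).
have phiE x : g (phi x) = f x by rewrite /phi; case: (cid _).
have phiB : zmod_morphism phi.
  by move=> x y; apply: ginj; rewrite rmorphB !phiE rmorphB.
have phiM : monoid_morphism phi.
  by split=> [|x y]; apply: ginj; rewrite ?rmorph1 ?rmorphM !phiE ?rmorph1 ?rmorphM.
pose phiZ := GRing.isZmodMorphism.Build _ _ phi phiB.
pose phiR := GRing.isMonoidMorphism.Build _ _ phi phiM.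
pose phi' : {rmorphism A -> B} := HB.pack phi phiZ phiR.
exists phi', (fun y => projT1 (cid (gf y))) => [x|y] /=.
  by case: (cid _) => z /=; rewrite phiE => /finj.
by apply: ginj; rewrite phiE; case: (cid _).
Qed.

Section Coefficients.
Variable S : comPzRingType.

(** With its converse [poly_eval_exists], this confines the case split on [1 = 0] to this section:
    later arguments see only coefficient sums. *)
Lemma poly_eval_coef (F : poly_ring S) :
  exists n (c : nat -> S), forall a, poly_eval F a = \sum_(j < n) c j * a ^+ j.
Proof.
rewrite /poly_eval; move: F; rewrite /poly_ring.
case: nontrivial_dec => [nz F|/negP/negPn/eqP S0 F].
  by exists (size (F : {poly nz_ring nz})), (fun j => F`_j) => a;
    exact: (@horner_coef (nz_ring nz)).
(* In the trivial ring every value is 0, so the empty sum suffices. *)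
by exists 0, (fun=> 0) => a; rewrite -[LHS]mul1r S0 mul0r big_ord0.
Qed.

Lemma poly_eval_exists n (c : nat -> S) :
  exists F : poly_ring S, forall a, poly_eval F a = \sum_(j < n) c j * a ^+ j.
Proof.
rewrite /poly_eval /poly_ring.
case: nontrivial_dec => [nz|/negP/negPn/eqP S0].
  by exists (\poly_(j < n) (c j : nz_ring nz)) => a;
    exact: (@horner_poly (nz_ring nz)).
by exists 0 => a; rewrite -[LHS]mul1r -[RHS]mul1r S0 !mul0r.
Qed.

End Coefficients.

Section DirectProductEvaluation.
Variables (I : finType) (R : I -> finComPzRingType).
Local Notation P := (fin_prod_ring R).

Definition coord i (a : P) : R i := (a : {dffun forall i, R i}) i.

Fact coord_zmod i : zmod_morphism (@coord i).
Proof. by move=> a b; rewrite /coord !ffunE. Qed.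
Fact coord_monoid i : monoid_morphism (@coord i).
Proof. by split=> [|a b]; rewrite /coord !ffunE. Qed.
HB.instance Definition _ i :=
  GRing.isZmodMorphism.Build _ _ (@coord i) (@coord_zmod i).
HB.instance Definition _ i :=
  GRing.isMonoidMorphism.Build _ _ (@coord i) (@coord_monoid i).

Definition of_coords (a : forall i, R i) : P :=
  [ffun i => a i] : {dffun forall i, R i}.

Lemma of_coordsK a i : coord i (of_coords a) = a i.
Proof. exact: ffunE. Qed.

Lemma coordP (a b : P) : (forall i, coord i a = coord i b) -> a = b.
Proof. by move=> ab; apply/ffunP. Qed.

(** Projection is a ring morphism, so [G] arises from [F] by projecting each coefficient. *)
Lemma coord_poly_eval i (F : poly_ring P) :
  exists G : poly_ring (R i),
    forall a, coord i (poly_eval F a) = poly_eval G (coord i a).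
Proof.
have [n [c Fc]] := poly_eval_coef F.
have [G Gc] := poly_eval_exists n (fun j => coord i (c j)).
exists G => a; rewrite Fc Gc rmorph_sum.
by apply: eq_bigr => j _; rewrite rmorphM rmorphXn.
Qed.

Lemma poly_eval_coords (G : forall i, poly_ring (R i)) :
  exists F : poly_ring P,
    forall a i, coord i (poly_eval F a) = poly_eval (G i) (coord i a).
Proof.
have /(_ _)/cid-/all_tag[n /(_ _)/cid-/all_tag[c Gc]] i := poly_eval_coef (G i).
(* The coefficient of degree [j] collects those of all the [G i], with 0 wherever [G i] has already
   run out; the maximum of the [n i] bounds all lengths. *)
pose d j := of_coords (fun i => if (j < n i)%N then c i j else 0).
have [F Fd] := poly_eval_exists (\max_i n i) d.
exists F => a i; rewrite Fd Gc rmorph_sum.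
(* The sum for [G i] is stretched to the common length, its extra terms becoming 0, to match
   termwise. *)
rewrite (big_ord_widen _ (fun j => c i j * coord i a ^+ j) (leq_bigmax i)).
rewrite [RHS]big_mkcond; apply: eq_bigr => j _.
rewrite rmorphM rmorphXn /d /= of_coordsK.
by case: ifP => // _; rewrite mul0r.
Qed.

End DirectProductEvaluation.

Section ProductOfFunctionRings.
Variables (I : finType) (R : I -> finComPzRingType).
Variable B : I -> comPzRingType.
Variable g : forall i, {rmorphism B i -> {ffun R i -> R i}}.
Local Notation P := (fin_prod_ring R).

(** Keeping [B] and [g] abstract lets one argument serve both the rings of polynomial functions and
    the quotients. *)
Definition prod_fun (y : prod_ring B) : {ffun P -> P} :=
  [ffun a => of_coords (fun i => g i ((y : {dffun forall i, B i}) i) (coord i a))].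

Lemma prod_funE y a i :
  coord i (prod_fun y a) = g i ((y : {dffun forall i, B i}) i) (coord i a).
Proof. by rewrite ffunE of_coordsK. Qed.

Fact prod_fun_zmod : zmod_morphism prod_fun.
Proof.
move=> x y; apply/ffunP => a; apply: coordP => i.
by rewrite prod_funE !ffunE rmorphB !ffunE raddfB /= !of_coordsK.
Qed.
Fact prod_fun_monoid : monoid_morphism prod_fun.
Proof.
split=> [|x y]; apply/ffunP => a; apply: coordP => i.
  by rewrite prod_funE !ffunE rmorph1 !ffunE rmorph1.
by rewrite prod_funE !ffunE rmorphM !ffunE rmorphM /= !of_coordsK.
Qed.
HB.instance Definition _ :=
  GRing.isZmodMorphism.Build _ _ prod_fun prod_fun_zmod.
HB.instance Definition _ :=
  GRing.isMonoidMorphism.Build _ _ prod_fun prod_fun_monoid.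

Hypothesis ginj : forall i, injective (g i).
Hypothesis gimage : forall i f,
  f \in @poly_function (R i) <-> exists y, g i y = f.

Lemma prod_fun_inj : injective prod_fun.
Proof.
move=> x y xy; apply/ffunP => i; apply: ginj; apply/ffunP => r.
(* The point with [r] at [i] and 0 elsewhere shows that every [r] in [R i] is a coordinate, so
   [prod_fun x] determines each [g i (x i)]. *)
have := prod_funE x (of_coords (dfwith (fun j => 0 : R j) r)) i.
by rewrite xy prod_funE of_coordsK dfwith_in => ->.
Qed.

(** A polynomial on [P] splits into coordinates by [coord_poly_eval], and a family of polynomials is
    glued by [poly_eval_coords]; [gimage] translates between polynomials over [R i] and elements of
    [B i]. *)
Lemma prod_fun_image f :
  f \in @poly_function P <-> exists y, prod_fun y = f.
Proof.
split=> [/poly_functionP[F Ff]|[y <-]]; last first.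
  have /(_ _)/cid-/all_tag[G Gy] i : exists G : poly_ring (R i),
      forall r, g i ((y : {dffun forall i, B i}) i) r = poly_eval G r.
    by apply/poly_functionP/gimage; eexists.
  have [F FG] := poly_eval_coords G.
  apply/poly_functionP; exists F => a; apply: coordP => i.
  by rewrite prod_funE Gy FG.
have /(_ _)/cid-/all_tag[y yF] i :
    exists y, forall a, coord i (f a) = g i y (coord i a).
  have [G GF] := coord_poly_eval i F.
  have [y yG] : exists y, g i y = [ffun r => poly_eval G r].
    by apply/gimage/poly_functionP; exists G => r; rewrite ffunE.
  by exists y => a; rewrite Ff GF yG ffunE.
exists ([ffun i => y i] : {dffun forall i, B i}).
by apply/ffunP => a; apply: coordP => i; rewrite prod_funE ffunE yF.
Qed.

Lemma prod_ring_isomorphic (A : comPzRingType)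
    (h : {rmorphism A -> {ffun P -> P}}) :
  injective h -> (forall f, f \in @poly_function P <-> exists x, h x = f) ->
  ring_isomorphic A (prod_ring B).
Proof.
move=> hinj himage.
apply: (@ring_isomorphic_same_image _ _ _ h prod_fun hinj prod_fun_inj) => x.
  by apply/prod_fun_image/himage; exists x.
by apply/himage/prod_fun_image; exists x.
Qed.

End ProductOfFunctionRings.

Section FunctionEmbeddings.
Variable S : finComPzRingType.

Lemma polyfun_val_image f :
  f \in @poly_function S <-> exists x : polyfun S, val x = f.
Proof. by split=> [Sf|[x <-]]; [exists (Polyfun Sf) | exact: polyfun_valP]. Qed.

Definition quot_fun (x : poly_quot S) : {ffun S -> S} :=
  [ffun a => poly_eval (repr x) a].

(** Two representatives of a class differ by a vanishing polynomial, so the choice made by [repr]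
    does not affect values. *)
Lemma quot_fun_pi (F : poly_ring S) a :
  quot_fun (\pi_(poly_quot S)%qT F) a = poly_eval F a.
Proof.
rewrite ffunE; set F' := repr _.
have /pi_poly_quotP/vanishingP/(_ a) :
    \pi_(poly_quot S)%qT F' = \pi_(poly_quot S)%qT F by rewrite reprK.
by rewrite poly_evalB => /subr0_eq.
Qed.

Fact quot_fun_zmod : zmod_morphism quot_fun.
Proof.
move=> x y; apply/ffunP => a; rewrite -[x]reprK -[y]reprK.
(* The difference of classes is rewritten as the class of a difference, so that [quot_fun_pi]
   applies. *)
transitivity (quot_fun (\pi_(poly_quot S)%qT (repr x - repr y)) a).
  congr (quot_fun _ a); exact/esym/(raddfB (\pi_(poly_quot S)%qT)).
by rewrite quot_fun_pi poly_evalB -!quot_fun_pi !ffunE.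
Qed.
Fact quot_fun_monoid : monoid_morphism quot_fun.
Proof.
split=> [|x y]; apply/ffunP => a.
  by rewrite quot_fun_pi poly_eval1 ffunE.
rewrite -[x]reprK -[y]reprK -[_ * _]pi_poly_quotM.
by rewrite quot_fun_pi poly_evalM -!quot_fun_pi !ffunE.
Qed.
HB.instance Definition _ :=
  GRing.isZmodMorphism.Build _ _ quot_fun quot_fun_zmod.
HB.instance Definition _ :=
  GRing.isMonoidMorphism.Build _ _ quot_fun quot_fun_monoid.

(** If two classes give the same function, the difference of their representatives vanishes
    everywhere, which is equality in the quotient. *)
Lemma quot_fun_inj : injective quot_fun.
Proof.
move=> x y xy; rewrite -[x]reprK -[y]reprK.
apply/pi_poly_quotP/vanishingP => a.
by rewrite poly_evalB -!quot_fun_pi !reprK xy subrr.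
Qed.

Lemma quot_fun_image f :
  f \in @poly_function S <-> exists x, quot_fun x = f.
Proof.
split=> [/poly_functionP[F Ff]|[x <-]].
  exists (\pi_(poly_quot S)%qT F).
  by apply/ffunP => a; rewrite quot_fun_pi Ff.
by apply/poly_functionP; exists (repr x) => a; rewrite ffunE.
Qed.

End FunctionEmbeddings.

Theorem theorem2 (k : nat) (hk : (2 <= k)%N) (R : 'I_k -> finComPzRingType) :
  ring_isomorphic (polyfun (fin_prod_ring R))
                  (prod_ring (fun i : 'I_k => polyfun (R i)))
  /\ ring_isomorphic (poly_quot (fin_prod_ring R))
                     (prod_ring (fun i : 'I_k => poly_quot (R i))).
Proof.
split.
- apply: (@prod_ring_isomorphic _ R (fun i => polyfun (R i))
    (fun i => val : {rmorphism polyfun (R i) -> {ffun R i -> R i}}) _ _ _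
    (val : {rmorphism polyfun (fin_prod_ring R) -> _})).
  + by move=> i; exact: val_inj.
  + by move=> i; exact: polyfun_val_image.
  + exact: val_inj.
  + exact: polyfun_val_image.
- apply: (@prod_ring_isomorphic _ R (fun i => poly_quot (R i))
    (fun i => @quot_fun (R i) : {rmorphism _ -> _}) _ _ _
    (@quot_fun (fin_prod_ring R) : {rmorphism _ -> _})).
  + by move=> i; exact: quot_fun_inj.
  + by move=> i; exact: quot_fun_image.
  + exact: quot_fun_inj.
  + exact: quot_fun_image.
Qed.
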